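(* Let $f_k(z)=\sum_{n\ge1}\gamma_k(n)q^n$ ($k\ge 2$) be as in the context, and let $C(n)=\sum_{j=0}^{n}\binom{n}{j}^2\binom{2j}{j}$. Then for any prime $p>3$ and integer $r\ge 1$, $$C\left(\frac{p^r-1}{2}\right) \equiv \gamma_{2r+1}(p) \pmod{p}.$$
   Context: For each integer $k\ge 2$, $f_k(z)=\sum_{n\ge1}\gamma_k(n)q^n$ is a weight $k$ newform with complex multiplication by $\mathbb{Q}(\sqrt{-3})$, lying in $S_k(\Gamma_0(36))$ if $k\equiv 0,2 \pmod 6$, in $S_k(\Gamma_0(3),(\tfrac{-3}{\cdot}))$ if $k\equiv 1\pmod 6$, in $S_k(\Gamma_0(12),(\tfrac{-3}{\cdot}))$ if $k\equiv 3,5\pmod 6$, and in $S_k(\Gamma_0(9))$ if $k\equiv 4\pmod 6$, whose coefficients at odd primes $p$ are: $\gamma_k(p)=(a+b\sqrt{-3})^{k-1}+(a-b\sqrt{-3})^{k-1}$ if $p\equiv 1\pmod 6$, where $p=a^2+3b^2$ with integers $a\equiv 1\pmod 3$, $b>0$; $\gamma_k(3)=(-3)^{(k-1)/2}$ if $k$ is odd; and $\gamma_k(p)=0$ otherwise. *)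

(* Defs.v *)
From HB Require Import structures.
From mathcomp Require Export all_boot all_order all_algebra.
From mathcomp Require Export all_classical all_reals all_analysis.
From mathcomp Require Export complex.

Set Implicit Arguments.
Unset Strict Implicit.
Unset Printing Implicit Defensive.

Import Order.TTheory GRing.Theory Num.Theory.
Import numFieldNormedType.Exports.
Local Open Scope ring_scope.
Local Open Scope classical_set_scope.

Definition Cseq (n : nat) : nat :=
  (\sum_(j < n.+1) 'C(n, j) ^ 2 * 'C(2 * j, j))%N.

(* The Kronecker symbol (-3 / .), i.e. the odd character of conductor 3 that
   corresponds to the quadratic field Q(sqrt(-3)). *)
Definition kronecker_m3 (d : int) : int :=
  if (d %% 3)%Z == 1 then 1 else if (d %% 3)%Z == 2 then -1 else 0.

Definition SL2Z : set 'M[int]_2 := [set g | \det g = 1].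

Definition Gamma0 (N : nat) : set 'M[int]_2 :=
  [set g | SL2Z g /\ (N %| g 1%R 0%R)%Z].

(* [s] represents each coset of Gamma0(N) \ SL2(Z) exactly once. *)
Definition coset_representatives (N : nat) (s : seq 'M[int]_2) : Prop :=
  [/\ uniq s, (forall g, g \in s -> SL2Z g) &
    forall g, SL2Z g ->
      exists! a, a \in s /\ exists2 h, Gamma0 N h & g = h *m a].

Section ModularForms.
Variable R : realType.

(* The topology and the normed-module structure of the complex numbers are
   attached to the alias R[i]^o. *)
Local Notation C := R[i].
Local Notation Co := (R[i]^o).

Definition upper_half_plane : set C := [set z | 0 < complex.Im z].

Definition automorphy (g : 'M[int]_2) (z : C) : C :=
  (g 1 0)%:~R * z + (g 1 1)%:~R.

Definition moebius (g : 'M[int]_2) (z : C) : C :=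
  ((g 0 0)%:~R * z + (g 0 1)%:~R) / automorphy g z.

Definition slash (k : nat) (g : 'M[int]_2) (f : C -> C) (z : C) : C :=
  automorphy g z ^- k * f (moebius g z).

Definition dirichlet_character (N : nat) (chi : int -> C) : Prop :=
  [/\ forall m n, chi (m * n) = chi m * chi n,
      forall n, chi (n + N%:Z) = chi n &
      forall n, (chi n == 0) = ~~ coprimez n N%:Z].

(* S_k(Gamma0(N), chi) *)
Definition cusp_form (k N : nat) (chi : int -> C) (f : C -> C) : Prop :=
  [/\ forall z, upper_half_plane z -> derivable (f : Co -> Co) z 1,
      forall g z, Gamma0 N g -> upper_half_plane z ->
        f (moebius g z) = chi (g 1 1) * automorphy g z ^+ k * f z &
      forall g, SL2Z g -> forall e : R, 0 < e ->
        exists Y : R, forall z, upper_half_plane z -> Y < complex.Im z ->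
          `|slash k g f z| < e%:C%C].

(* q = exp (2 i pi z) *)
Definition nome (z : C) : C :=
  (expR (- (2 * pi * complex.Im z)))%:C%C *
  (cos (2 * pi * complex.Re z) +i* sin (2 * pi * complex.Re z))%C.

Definition q_expansion (f : C -> C) (a : nat -> C) : Prop :=
  forall z, upper_half_plane z ->
    (series (fun n => a n.+1 * nome z ^+ n.+1 : Co) : nat -> Co) @ \oo
      --> (f z : Co).

Definition fundamental_domain : set (R * R) :=
  [set w | [/\ `|w.1| <= 2^-1, 0 < w.2 & 1 <= w.1 ^+ 2 + w.2 ^+ 2]].

Definition complex_integral (D : set (R * R)) (F : C -> C) : C :=
  let mu := (@lebesgue_measure R \x @lebesgue_measure R)%E in
  (Rintegral mu D (fun w => complex.Re (F (w.1 +i* w.2)%C)) +i*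
   Rintegral mu D (fun w => complex.Im (F (w.1 +i* w.2)%C)))%C.

(* The Petersson product
     \int_(Gamma0(N) \ H) f(z) conj(g(z)) Im(z)^k dx dy / y^2,
   cut into translates of the fundamental domain of SL2(Z) by the coset
   representatives [s]. *)
Definition petersson (k : nat) (s : seq 'M[int]_2) (f g : C -> C) : C :=
  \sum_(h <- s) complex_integral fundamental_domain (fun z =>
    f (moebius h z) * (g (moebius h z))^* *
    (complex.Im (moebius h z) ^+ k / complex.Im z ^+ 2)%:C%C).

(* Orthogonality to the space spanned by the g(dz) with g in
   S_k(Gamma0(M), psi), M a proper divisor of N, d | N/M, where chi is the
   character modulo N induced by psi. The value of the Petersson product does
   not depend on the choice of the representatives. *)
Definition in_new_subspace (k N : nat) (chi : int -> C) (f : C -> C) : Prop :=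
  forall (M d : nat) (psi : int -> C) (g : C -> C) (s : seq 'M[int]_2),
    (M %| N)%N -> (M < N)%N -> (d %| N %/ M)%N ->
    dirichlet_character M psi ->
    (forall n, coprimez n N%:Z -> chi n = psi n) ->
    cusp_form k M psi g ->
    coset_representatives N s ->
    petersson k s f (fun z => g (d%:R * z)) = 0.

(* The m-th Fourier coefficient of T_n f, for f = \sum_n a(n) q^n in
   S_k(Gamma0(N), chi). *)
Definition hecke_coef (k : nat) (chi : int -> C) (n : nat) (a : nat -> C)
    (m : nat) : C :=
  \sum_(d <- divisors (gcdn m n))
     chi d%:Z * d%:R ^+ (k - 1) * a (m * n %/ d ^ 2)%N.

Definition hecke_eigenform (k : nat) (chi : int -> C) (a : nat -> C) : Prop :=
  forall n, (0 < n)%N -> exists lambda : C,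
    forall m, (0 < m)%N -> hecke_coef k chi n a m = lambda * a m.

Definition newform (k N : nat) (chi : int -> C) (f : C -> C) (a : nat -> C)
    : Prop :=
  [/\ dirichlet_character N chi, cusp_form k N chi f & q_expansion f a] /\
  [/\ in_new_subspace k N chi f, hecke_eigenform k chi a & a 1%N = 1].

Definition has_CM_by_Qsqrtm3 (a : nat -> C) : Prop :=
  exists B : nat, forall p : nat, prime p -> (B < p)%N ->
    (kronecker_m3 p%:Z)%:~R * a p = a p.

Definition level (k : nat) : nat :=
  match (k %% 6)%N with
  | 0 | 2 => 36
  | 1 => 3
  | 3 | 5 => 12
  | _ => 9
  end.

(* The characters are taken modulo the level: they vanish at the integers that
   are not coprime to it. *)
Definition nebentypus (k : nat) (d : int) : C :=
  if coprimez d (level k)%:Z then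
    if odd k then (kronecker_m3 d)%:~R else 1
  else 0.

Definition odd_prime_coefs (k : nat) (a : nat -> C) : Prop :=
  forall p : nat, prime p -> odd p ->
  [/\ (p = 1 %[mod 6])%N ->
        forall x y : int, p%:Z = x ^+ 2 + 3 * y ^+ 2 ->
          (x = 1 %[mod 3])%Z -> 0 < y ->
          a p = (x%:~R + y%:~R * sqrtC (- 3)) ^+ (k - 1)
              + (x%:~R - y%:~R * sqrtC (- 3)) ^+ (k - 1),
      p = 3%N -> odd k -> a p = (- 3) ^+ ((k - 1) %/ 2) &
      (p <> 1 %[mod 6])%N -> ~ (p = 3%N /\ odd k) -> a p = 0].

Definition is_fk (k : nat) (f : C -> C) (a : nat -> C) : Prop :=
  [/\ newform k (level k) (nebentypus k) f a,
      has_CM_by_Qsqrtm3 a &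
      odd_prime_coefs k a].

End ModularForms.

(* Main.v *)
(** Write p = 2m + 1. Since all base p digits of (p^r - 1) / 2 equal m, Lucas'
    theorem reduces the claim to C(m) mod p. Modulo p, Clausen's formula for the
    square of a Legendre polynomial gives C(m) = H(z)^2, where
    H(z) = \sum_j binom(m, j)^2 z^j and z is a primitive sixth root of unity in a
    field of characteristic p. Now H(z) is the coefficient of t^(p-1) in
    (t (1 + t) (1 + z t))^m, and this cubic is (1 + a t)^3 - 1 up to a scalar, with
    a = 1 + z; so H(z) = 0 if p = 2 mod 3, and H(z)^2 = binom(3f, f)^2 if
    p = 6f + 1. In the latter case - binom(3f, f) is the residue of the
    Jacobsthal sum \sum_t (1 + t^3 / p), which is 2u for a representation
    p = u^2 + 3v^2, and 4u^2 is congruent to the trace of (u + v sqrt(-3))^2. *)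

Require Import Defs.
From mathcomp Require Import all_solvable all_field ring zify.
Set Implicit Arguments.
Unset Strict Implicit.
Unset Printing Implicit Defensive.
Import Order.TTheory GRing.Theory Num.Theory.
Local Open Scope ring_scope.

(** * Clausen's formula for Legendre polynomials *)

Definition legendre_coef (n j : nat) : int :=
  (-1) ^+ j * ('C(n, j) * 'C(n + j, j))%:Z.

Lemma legendre_coefS (n j : nat) :
  legendre_coef n j.+1 * (j%:Z + 1) ^+ 2
  = legendre_coef n j * (j%:Z * (j%:Z + 1) - n%:Z * (n%:Z + 1)).
Proof.
rewrite /legendre_coef.
case: (leqP j n) => [le_jn|lt_nj]; last first.
  by rewrite (bin_small lt_nj) (@bin_small n j.+1) 1?ltnW // !mul0n !mulr0 !mul0r.
have e1 : (j%:Z + 1) * 'C(n, j.+1)%:Z = (n%:Z - j%:Z) * 'C(n, j)%:Z.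
  by rewrite subzn // -PoszD -!PoszM addn1 mul_bin_left.
have e2 : (j%:Z + 1) * 'C(n + j.+1, j.+1)%:Z = (n%:Z + j%:Z + 1) * 'C(n + j, j)%:Z.
  by rewrite -!PoszD -!PoszM !addn1 addnS -mul_bin_diag.
rewrite !PoszM exprS.
transitivity (- (-1) ^+ j * ((j%:Z + 1) * 'C(n, j.+1)%:Z) *
              ((j%:Z + 1) * 'C(n + j.+1, j.+1)%:Z)); first by ring.
by rewrite e1 e2; ring.
Qed.

(** The coefficients of the hypergeometric polynomial 3F2(-n, n+1, 1/2; 1, 1; 4X). *)
Definition clausen_coef (n j : nat) : int := legendre_coef n j * 'C(2 * j, j)%:Z.

Lemma clausen_coefS (n j : nat) :
  clausen_coef n j.+1 * (j%:Z + 1) ^+ 3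
  = clausen_coef n j * (2 * (2 * j%:Z + 1) * (j%:Z * (j%:Z + 1) - n%:Z * (n%:Z + 1))).
Proof.
have e : (j%:Z + 1) * 'C(2 * j.+1, j.+1)%:Z = 2 * (2 * j%:Z + 1) * 'C(2 * j, j)%:Z.
  have e1 : (j.+1 * 'C(2 * j.+1, j.+1) = (2 * j).+2 * 'C((2 * j).+1, j))%N.
    by rewrite mul_bin_diag mulnS.
  have e2 : (j.+1 * 'C((2 * j).+1, j) = (2 * j).+1 * 'C(2 * j, j))%N.
    rewrite (_ : j.+1 = (2 * j).+1 - j)%N ?mul_bin_down //; lia.
  have e3 : (j.+1 * 'C(2 * j.+1, j.+1) = 2 * (2 * j).+1 * 'C(2 * j, j))%N.
    by rewrite e1 -mulnA -e2 mulnA mulnS.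
  by lia.
rewrite /clausen_coef.
transitivity ((legendre_coef n j.+1 * (j%:Z + 1) ^+ 2) *
              ((j%:Z + 1) * 'C(2 * j.+1, j.+1)%:Z)); first by ring.
by rewrite legendre_coefS e; ring.
Qed.

Lemma legendre_coef_eq0 n j : (n < j)%N -> legendre_coef n j = 0.
Proof. by move=> lt_nj; rewrite /legendre_coef bin_small // mul0n mulr0. Qed.

(* The Legendre polynomial [P_n (1 - 2 X)]. *)
Definition legendre_poly (n : nat) : {poly int} :=
  \poly_(j < n.+1) legendre_coef n j.

Definition clausen_poly (n : nat) : {poly int} :=
  \poly_(j < n.+1) clausen_coef n j.

Lemma coef_legendre_poly n j : (legendre_poly n)`_j = legendre_coef n j.
Proof. by rewrite coef_poly; case: ltnP => // /legendre_coef_eq0. Qed.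

Lemma coef_clausen_poly n j : (clausen_poly n)`_j = clausen_coef n j.
Proof.
rewrite coef_poly; case: ltnP => // lt_nj.
by rewrite /clausen_coef legendre_coef_eq0 ?mul0r.
Qed.

Lemma coefX_deriv (P : {poly int}) j : ('X * P^`())`_j = j%:Z * P`_j.
Proof.
by rewrite coefXM; case: j => [|j]; rewrite ?mul0r // coef_deriv -mulr_natl natz.
Qed.

Lemma coef_derivX (P : {poly int}) j : ('X * P)^`()`_j = (j%:Z + 1) * P`_j.
Proof. by rewrite coef_deriv coefXM /= -mulr_natl -natr1 natz. Qed.

Lemma legendre_poly_ode (n : nat) :
  ('X * (1 - 'X) * (legendre_poly n)^`())^`()
  = - (n%:Z * (n%:Z + 1))%:P * legendre_poly n.
Proof.
apply/polyP => j; set F := legendre_poly n.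
have -> : ('X * (1 - 'X) * F^`())^`() = ('X * F^`())^`() - ('X * ('X * F^`()))^`().
  by rewrite -derivB; congr (_^`()); ring.
rewrite coefB !coef_derivX coefX_deriv coef_deriv -polyCN coefCM.
have := legendre_coefS n j; rewrite -!coef_legendre_poly -/F -mulr_natr => e.
rewrite -natr1 natz.
transitivity (F`_j.+1 * (j%:Z + 1) ^+ 2 - (j%:Z + 1) * j%:Z * F`_j); first by ring.
by rewrite e; ring.
Qed.

(* If [F] solves [(A F')' + l F = 0] with [A = X (1 - X)], this third-order
   operator, the symmetric square, annihilates [F ^+ 2]. *)
Definition sym_sqr_op (l : int) (G : {poly int}) : {poly int} :=
  let A := 'X * (1 - 'X) in
  (A * (A * G^`())^`() + (2 * l)%:P * (A * G))^`() + (2 * l)%:P * (A * G^`()).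

(** With G = F^2 the equation for F gives A(AG')' + 2lAG = 2(AF')^2. The derivative of the right
    side is -4l F (AF') = -2l AG', which cancels the last term of the operator. *)
Lemma sym_sqr_opP (l : int) (F : {poly int}) :
  ('X * (1 - 'X) * F^`())^`() = - l%:P * F -> sym_sqr_op l (F ^+ 2) = 0.
Proof.
move=> ode; rewrite /sym_sqr_op.
set A := 'X * (1 - 'X) in ode *.
have dG : (F ^+ 2)^`() = 2%:P * (F * F^`()).
  by rewrite expr2 derivM (_ : 2%:P = 2) ?rmorph_nat //; ring.
have dAG : (A * (F ^+ 2)^`())^`() = 2%:P * (F^`() * (A * F^`()) - l%:P * F ^+ 2).
  have -> : A * (F ^+ 2)^`() = 2%:P * (F * (A * F^`())) by rewrite dG; ring.
  rewrite derivM derivC mul0r add0r derivM ode; ring.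
have -> : A * (A * (F ^+ 2)^`())^`() + (2 * l)%:P * (A * F ^+ 2)
          = 2%:P * ((A * F^`()) * (A * F^`())).
  by rewrite dAG polyCM; ring.
rewrite derivM derivC mul0r add0r derivM ode dG !polyCM.
by rewrite (_ : 2%:P = 2) ?rmorph_nat //; ring.
Qed.

(** Change of variable to A = X(1 - X): since A'^2 = 1 - 4A, all terms become polynomials in A up to
    one common factor A' = 1 - 2X. *)
Lemma sym_sqr_op_comp (l : int) (P : {poly int}) :
  sym_sqr_op l (P \Po ('X * (1 - 'X))) =
  ((('X * (('X * P^`())^`() * (1 - 4%:P * 'X) - 2%:P * ('X * P^`())))^`()
    + (2 * l)%:P * ('X * P)^`() + (2 * l)%:P * ('X * P^`())) \Po ('X * (1 - 'X)))
  * (1 - 2%:P * 'X).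
Proof.
rewrite /sym_sqr_op; set A := 'X * (1 - 'X).
set Q := _ - _.
have dA : A^`() = 1 - 2%:P * 'X.
  by rewrite /A derivM derivB derivX derivC (_ : 2%:P = 2) ?rmorph_nat //; ring.
have dAA : (1 - 2%:P * 'X)^`() = - 2%:P :> {poly int}.
  by rewrite derivB derivC derivM derivC derivX mul0r mulr1 !add0r.
have eA : (1 - 2%:P * 'X) ^+ 2 = 1 - 4%:P * A :> {poly int}.
  have p2 : 2%:P = 2 :> {poly int} by rewrite rmorph_nat.
  have p4 : 4%:P = 4 :> {poly int} by rewrite rmorph_nat.
  by rewrite p2 p4 /A; ring.
have eAP : A * (P \Po A)^`() = (('X * P^`()) \Po A) * (1 - 2%:P * 'X).
  by rewrite deriv_comp comp_polyM comp_polyX dA; ring.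
have eQ : (A * (P \Po A)^`())^`() = Q \Po A.
  rewrite eAP derivM deriv_comp dAA dA -mulrA -expr2 eA /Q.
  rewrite comp_polyB !comp_polyM comp_polyB comp_polyM !comp_polyC comp_polyX.
  by rewrite ?polyC1; ring.
rewrite eQ eAP; move: Q {eQ} => Q.
have -> : A * (Q \Po A) + (2 * l)%:P * (A * (P \Po A))
          = ('X * Q + (2 * l)%:P * ('X * P)) \Po A.
  by rewrite comp_polyD !comp_polyM !comp_polyC comp_polyX.
rewrite deriv_comp dA derivD [((2 * l)%:P * _)^`()]derivM derivC mul0r add0r.
by rewrite !comp_polyD !comp_polyM !comp_polyC; ring.
Qed.

Lemma sym_sqr_op_clausen (n : nat) :
  sym_sqr_op (n%:Z * (n%:Z + 1)) (clausen_poly n \Po ('X * (1 - 'X))) = 0.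
Proof.
rewrite sym_sqr_op_comp; set P := clausen_poly n; set l := _ * (_ + 1).
(* The third-order operator in the variable A already kills [P]: its coefficients form the
   recurrence [clausen_coefS]. *)
set W := (W in W \Po _); suff -> : W = 0 by rewrite comp_poly0 mul0r.
apply/polyP => j; rewrite coef0 /W.
have -> : ('X * P^`())^`() * (1 - 4%:P * 'X) - 2%:P * ('X * P^`())
   = ('X * P^`())^`() - 4%:P * ('X * ('X * P^`())^`()) - 2%:P * ('X * P^`()) by ring.
rewrite !coefD !coefCM !coef_derivX coefX_deriv !coefB !coefCM.
rewrite !coefX_deriv coef_deriv coefX_deriv -mulr_natl -natr1 natz.
have := clausen_coefS n j; rewrite -!coef_clausen_poly -/P -/l => e.
transitivity (P`_j.+1 * (j%:Z + 1) ^+ 3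
   + P`_j * (2 * (2 * j%:Z + 1) * (l - j%:Z * (j%:Z + 1)))); first by ring.
by rewrite e; ring.
Qed.

Lemma sym_sqr_opB l P Q : sym_sqr_op l (P - Q) = sym_sqr_op l P - sym_sqr_op l Q.
Proof.
rewrite /sym_sqr_op /= !(derivB, mulrBr, derivD); ring.
Qed.

(** The k-th coefficient of [sym_sqr_op l G] is (k+1)^3 G_(k+1) plus a combination of lower
    coefficients of G, so the constant term determines a solution. *)
Lemma sym_sqr_op_inj l (G : {poly int}) : G`_0 = 0 -> sym_sqr_op l G = 0 -> G = 0.
Proof.
move=> G0 opG; apply/polyP => k; rewrite coef0.
elim/ltn_ind: k => -[//|k] IH.
have Gle i : (i <= k)%N -> G`_i = 0 by apply: IH.
have [T TE] : exists T, T = 'X * G^`() by exists ('X * G^`()).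
have [V VE] : exists V, V = (T - 'X * T)^`() + (2 * l)%:P * G by eexists.
have opE : sym_sqr_op l G = ('X * (V - 'X * V))^`() + (2 * l)%:P * (T - 'X * T).
  rewrite /sym_sqr_op /=.
  have -> : 'X * (1 - 'X) * G^`() = T - 'X * T by rewrite TE; ring.
  by congr (_^`() + _); rewrite VE; ring.
have Vi i : V`_i = (i%:Z + 1) ^+ 2 * G`_i.+1 + (2 * l - (i%:Z + 1) * i%:Z) * G`_i.
  rewrite VE derivB coefD coefB coefCM (coef_derivX T) (coef_deriv T).
  by rewrite TE !coefX_deriv -mulr_natl intS -natr1 natz; ring.
have Tle i : (i <= k)%N -> T`_i = 0 by move=> ?; rewrite TE coefX_deriv Gle ?mulr0.
have := congr1 (fun P : {poly int} => P`_k) opG.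
rewrite opE coefD coef_derivX coefCM !coefB !coefXM coef0 Vi (Gle k) // (Tle k) //.
have -> : (if k == 0%N then 0 else V`_k.-1) = 0.
  case: k Gle {IH Tle} => // k Gle /=.
  by rewrite Vi !Gle ?mulr0 ?addr0 // leqW.
have -> : (if k == 0%N then 0 else T`_k.-1) = 0.
  by case: k Tle {IH Gle} => // k Tle; rewrite /= Tle // leqW.
have k1 : (k%:Z + 1 == 0) = false by lia.
by rewrite !(subr0, mulr0, addr0) => /eqP; rewrite !mulf_eq0 k1 => /eqP.
Qed.

(** Both sides are annihilated by the operator with l = n(n+1), and both have constant term 1. *)
Lemma clausen (n : nat) :
  legendre_poly n ^+ 2 = clausen_poly n \Po ('X * (1 - 'X)).
Proof.
apply/eqP; rewrite -subr_eq0; apply/eqP.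
apply: (@sym_sqr_op_inj (n%:Z * (n%:Z + 1))); last first.
  rewrite sym_sqr_opB sym_sqr_op_clausen subr0.
  by apply: sym_sqr_opP; apply: legendre_poly_ode.
rewrite -horner_coef0 hornerD hornerN horner_exp horner_comp.
rewrite hornerM hornerX mul0r !horner_coef0 coef_legendre_poly coef_clausen_poly.
by rewrite /clausen_coef /legendre_coef !bin0 expr0 !mulr1.
Qed.

(** * Binomial coefficients modulo p *)

Lemma coef_exp1DCX (R : comNzRingType) (c : R) (n j : nat) :
  ((1 + c%:P * 'X) ^+ n)`_j = 'C(n, j)%:R * c ^+ j.
Proof.
elim: n j => [|n IH] [|j]; rewrite ?expr0 ?coef1 ?bin0n ?mul0r ?mulr1 //.
  rewrite exprS mulrDl mul1r coefD -mulrA coefCM coefXM /= mulr0 addr0 IH.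
  by rewrite !bin0 expr0 mulr1.
rewrite exprS mulrDl mul1r coefD -mulrA coefCM coefXM /= !IH binS natrD exprS.
by ring.
Qed.

(** By Frobenius (1 + X)^p = 1 + X^p; splitting off one such factor at a time reproduces Pascal's
    rule for the upper digits [a1], [b1]. *)
Lemma lucas_bin (R : comNzRingType) (p : nat) : p \in [pchar R] ->
  forall a0 a1 b0 b1, (a0 < p)%N -> (b0 < p)%N ->
  'C(a0 + a1 * p, b0 + b1 * p)%:R = 'C(a0, b0)%:R * 'C(a1, b1)%:R :> R.
Proof.
move=> charRp a0 a1 b0 b1 lt_a0 lt_b0.
have binE n j : 'C(n, j)%:R = ((1 + 'X) ^+ n)`_j :> R.
  by rewrite -[X in 1 + X]mul1r -polyC1 coef_exp1DCX expr1n mulr1.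
elim: a1 b1 => [|a1 IH] b1.
  rewrite mul0n addn0; case: b1 => [|b1]; first by rewrite addn0 mulr1.
  by rewrite bin0n mulr0 bin_small // mulSn; lia.
have charP : (1 + 'X) ^+ p = 1 + 'X^p :> {poly R}.
  rewrite exprDn_pchar ?expr1n // pnatE ?pchar_poly //.
  exact: pcharf_prime charRp.
rewrite mulSn addnCA addnC binE exprD charP mulrDr mulr1 coefD coefMXn -!binE IH.
case: b1 => [|b1]; first by rewrite mul0n addn0 lt_b0 !bin0 addr0.
rewrite mulSn addnCA ltnNge leq_addr /= addKn IH binS natrD; ring.
Qed.

Section HalfBinomials.
Variables (L : fieldType) (p m : nat).
Hypotheses (charLp : p \in [pchar L]) (pE : p = m.*2.+1).

Lemma natr_lt_char_neq0 j : (0 < j < p)%N -> j%:R != 0 :> L.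
Proof.
move=> /andP[j0 jp]; rewrite -(dvdn_pcharf charLp).
by apply/negP => /(dvdn_leq j0); rewrite leqNgt jp.
Qed.

(** Formally binom(m+j, j) = (-1)^j binom(-m-1, j), and -m-1 = m modulo p = 2m+1. *)
Lemma bin_half_opp j : (j <= m)%N ->
  'C(m + j, j)%:R = (-1) ^+ j * 'C(m, j)%:R :> L.
Proof.
elim: j => [|j IH] le_jm; first by rewrite !bin0 mulr1.
have nz : j.+1%:R != 0 :> L by apply: natr_lt_char_neq0; lia.
apply: (mulfI nz).
have e1 : j.+1%:R * 'C(m + j.+1, j.+1)%:R = (m + j).+1%:R * 'C(m + j, j)%:R :> L.
  by rewrite -!natrM addnS mul_bin_diag.
have e2 : j.+1%:R * 'C(m, j.+1)%:R = (m - j)%:R * 'C(m, j)%:R :> L.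
  by rewrite -!natrM mul_bin_left.
have e3 : (m + j).+1%:R = - (m - j)%:R :> L.
  apply/eqP; rewrite -subr_eq0 opprK -natrD -(dvdn_pcharf charLp).
  by rewrite (_ : _ + _ = p)%N //; lia.
by rewrite e1 IH 1?ltnW // [RHS]mulrCA e2 exprS e3; ring.
Qed.

(* Up to sign, the Hasse invariant of the Legendre curve
   [y^2 = x (x - 1) (x - z)]. *)
Definition hasse (z : L) : L := \sum_(j < m.+1) 'C(m, j)%:R ^+ 2 * z ^+ j.

(** Modulo p the Legendre coefficients become binom(m, j)^2, so Clausen's formula is evaluated at z
    on the left, which gives [hasse z], and at z(1-z) = 1 on the right, which gives C(m). *)
Lemma Cseq_hasse (z : L) : z * (1 - z) = 1 -> (Cseq m)%:R = hasse z ^+ 2.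
Proof.
move=> z1; have legE j : (j <= m)%N -> (legendre_coef m j)%:~R = 'C(m, j)%:R ^+ 2 :> L.
  move=> le_jm; rewrite /legendre_coef rmorphM rmorphXn rmorphN1 /= PoszM intrM.
  rewrite -!pmulrn bin_half_opp //.
  transitivity ((-1) ^+ j * (-1) ^+ j * 'C(m, j)%:R ^+ 2 : L); first by ring.
  by rewrite -exprMn mulrNN mulr1 expr1n mul1r.
have evalE (E : nat -> int) (x : L) :
    (map_poly (intr : int -> L) (\poly_(j < m.+1) E j)).[x]
    = \sum_(j < m.+1) (E j)%:~R * x ^+ j.
  rewrite poly_def rmorph_sum horner_sum; apply: eq_bigr => j _.
  by rewrite /= map_polyZ map_polyXn hornerZ hornerXn.
have := congr1 (fun P => (map_poly (intr : int -> L) P).[z]) (clausen m).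
rewrite rmorphXn /= horner_exp map_comp_poly horner_comp.
rewrite rmorphM rmorphB rmorph1 /= map_polyX hornerM hornerD hornerN hornerC hornerX.
rewrite z1 !evalE => eq_sq; rewrite /hasse /Cseq.
transitivity (\sum_(i < m.+1) (clausen_coef m i)%:~R * 1 ^+ i : L).
  rewrite natr_sum; apply: eq_bigr => j _; rewrite /clausen_coef intrM.
  by rewrite legE -1?ltnS // expr1n mulr1 natrM natrX.
rewrite -eq_sq; congr (_ ^+ 2); apply: eq_bigr => j _.
by rewrite legE -1?ltnS.
Qed.

(* [3 a t (1 + t) (1 + z t) = (1 + a t)^3 - 1] for [a = 1 + z], so that the
   coefficient of [t^2m] in the m-th power can be read off both sides. *)
Lemma hasse_cube (z : L) : z * (1 - z) = 1 ->
  (3 * (1 + z)) ^+ m * hasse z = (1 + z) ^+ m.*2 *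
    \sum_(i < m.+1) (-1) ^+ i * 'C(m, i)%:R * 'C(3 * (m - i), m.*2)%:R.
Proof.
move=> z1; set a := 1 + z.
have a3 : a ^+ 3 = 3 * a * z.
  have z2 : z * z = z - 1 by rewrite -[X in _ = _ - X]z1; ring.
  have -> : a ^+ 3 = a * (1 + 2 * z + z * z) by rewrite /a; ring.
  by rewrite z2; ring.
have cubic : (3 * a)%:P * ('X * ((1 + z%:P * 'X) * (1 + 1%:P * 'X)))
             = (1 + a%:P * 'X) ^+ 3 - 1 :> {poly L}.
  have A3 : a%:P ^+ 3 = 3 * a%:P * z%:P :> {poly L}.
    by rewrite -polyC_exp a3 !polyCM rmorph_nat.
  have AE : a%:P = 1 + z%:P :> {poly L} by rewrite polyCD.
  rewrite polyCM rmorph_nat polyC1.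
  transitivity (3 * a%:P * 'X + 3 * a%:P * (1 + z%:P) * 'X ^+ 2
                + (3 * a%:P * z%:P) * 'X ^+ 3); first by ring.
  by rewrite -A3 -AE; ring.
have := congr1 (fun P : {poly L} => (P ^+ m)`_m.*2) cubic.
rewrite /= exprMn -polyC_exp coefCM [('X * _) ^+ m]exprMn coefXnM ltnNge.
rewrite -addnn leq_addr /= addnK.
rewrite [(_ * _) ^+ m in X in _ * X = _]exprMn coefM => eq_coef.
transitivity ((3 * a) ^+ m *
    \sum_(j < m.+1) ((1 + z%:P * 'X) ^+ m)`_j * ((1 + 1%:P * 'X) ^+ m)`_(m - j)).
  congr (_ * _); apply: eq_bigr => j _; have le_jm : (j <= m)%N by rewrite -ltnS.
  by rewrite !coef_exp1DCX expr1n mulr1 bin_sub //; ring.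
rewrite eq_coef exprBn coef_sum mulr_sumr; apply: eq_bigr => i _.
rewrite expr1n mulr1 -exprM coefMn -polyC1 -polyCN -polyC_exp coefCM coef_exp1DCX.
by rewrite -mulr_natr; ring.
Qed.

Lemma bin_pred_char_eq0 k : (p <= k < p + p.-1)%N -> 'C(k, p.-1)%:R = 0 :> L.
Proof.
move=> /andP[le_pk lt_k].
have := lucas_bin charLp (a0 := k - p) 1 (b0 := p.-1) 0.
rewrite mul1n mul0n addn0 subnK // => -> //; try lia.
by rewrite bin_small ?mul0r //; lia.
Qed.

(** The number 3(m-i) is below 2p-1 and differs from 2m = p-1: either it is less than 2m, or it is
    at least p and its last digit in base p is less than p-1. *)
Lemma bin_3mul_half_eq0 i : (0 < m)%N -> (i <= m)%N -> 3 * i != m ->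
  'C(3 * (m - i), m.*2)%:R = 0 :> L.
Proof.
move=> m0 le_im neq; case: (leqP p (3 * (m - i))) => [le_p|gt_p].
  have -> : m.*2 = p.-1 by rewrite pE.
  by rewrite bin_pred_char_eq0 //; lia.
by rewrite bin_small //; lia.
Qed.

Hypothesis three_neq0 : 3 != 0 :> L.
Variable z : L.
Hypothesis z_eq : z * (1 - z) = 1.

Let sqr_z : z * z = z - 1.
Proof. by rewrite -[X in _ = _ - X]z_eq; ring. Qed.

(** The norm of 1 + z is (1 + z)(2 - z) = 3. *)
Let oneDz_neq0 : 1 + z != 0.
Proof.
apply: contra three_neq0 => /eqP z1.
have -> : 3 = (1 + z) * (2 - z) + (z * z - (z - 1)) :> L by ring.
by rewrite z1 sqr_z; apply/eqP; ring.
Qed.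

(** If 3 does not divide m, no index satisfies 3i = m, and every term on the right of [hasse_cube]
    vanishes. *)
Lemma Cseq_half_eq0 : (0 < m)%N -> ~~ (3 %| m)%N -> (Cseq m)%:R = 0 :> L.
Proof.
move=> m0 m3; rewrite (Cseq_hasse z_eq).
have nz : (3 * (1 + z)) ^+ m != 0 by rewrite expf_neq0 // mulf_neq0.
suff -> : hasse z = 0 by rewrite expr0n.
apply: (mulfI nz); rewrite hasse_cube // mulr0 big1 ?mulr0 // => i _.
rewrite bin_3mul_half_eq0 ?mulr0 // -1?ltnS //.
by apply: contra m3 => /eqP <-; apply: dvdn_mulr.
Qed.

(** Only i = f survives in [hasse_cube], so (3a)^m H(z) = (-1)^f a^(2m) binom(m, f) with a = 1 + z.
    Squaring leaves the factor a^(2m) / 3^(2m) = 1 / (-3)^m = 1. *)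
Lemma Cseq_half_third f : (0 < f)%N -> m = (3 * f)%N -> (- 3) ^+ m = 1 :> L ->
  (Cseq m)%:R = 'C(m, f)%:R ^+ 2 :> L.
Proof.
move=> f0 mE m3; rewrite (Cseq_hasse z_eq).
have lt_fm : (f < m.+1)%N by lia.
have := hasse_cube z_eq.
rewrite (bigD1 (Ordinal lt_fm)) //= big1 => [|i neq_if]; last first.
  rewrite bin_3mul_half_eq0 ?mulr0 // -1?ltnS //; first by lia.
  by apply: contra neq_if => /eqP e; apply/eqP/val_inj => /=; lia.
have -> : (3 * (m - f) = m.*2)%N by lia.
rewrite binn mulr1 addr0 => /(congr1 (fun x => x ^+ 2)).
set a := 1 + z; set c := 'C(m, f)%:R; rewrite !exprMn => eqH.
have nz3 : 3 ^+ m != 0 :> L by rewrite expf_neq0.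
have nza : a ^+ m ^+ 2 != 0 :> L by rewrite !expf_neq0.
(* This uses a^2 = 3z and z^3 = -1, with m = 3f. *)
have aE : a ^+ m.*2 = 3 ^+ m * (-1) ^+ m.
  rewrite -mul2n exprM -exprMn (_ : a ^+ 2 = 3 * z).
    rewrite !exprMn [in z ^+ m]mE [in (-1) ^+ m]mE !exprM.
    congr (_ * _ ^+ _); transitivity (z * (z * z)); first by ring.
    by rewrite sqr_z mulrBr sqr_z; ring.
  have -> : a ^+ 2 = 1 + 2 * z + z * z by rewrite /a; ring.
  by rewrite sqr_z; ring.
have sgn n : (-1) ^+ n ^+ 2 = 1 :> L by rewrite -exprM mulnC exprM sqrrN !expr1n.
apply: (mulfI nz3); apply: (mulfI nza).
move: m3; rewrite -[- 3]mulN1r exprMn => m3.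
apply: (mulfI nz3); transitivity (3 ^+ m ^+ 2 * a ^+ m ^+ 2 * hasse z ^+ 2).
  by ring.
rewrite eqH aE sgn -exprM muln2 aE.
transitivity ((-1) ^+ m ^+ 2 * (3 ^+ m) ^+ 2 * c ^+ 2); first by ring.
rewrite sgn; transitivity ((-1) ^+ m * 3 ^+ m * 3 ^+ m * (3 ^+ m) * c ^+ 2); last by ring.
by rewrite m3; ring.
Qed.

End HalfBinomials.

(** * Lucas reduction of C((p^r - 1)/2) to C(m) *)

Lemma Cseq_widen n k : (n < k)%N ->
  Cseq n = (\sum_(0 <= j < k) 'C(n, j) ^ 2 * 'C(2 * j, j))%N.
Proof.
move=> lt_nk; rewrite (@big_cat_nat _ _ _ n.+1) //= /Cseq -[LHS]addn0 big_mkord.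
congr (_ + _)%N; rewrite big_nat big1 // => j /andP[lt_nj _].
by rewrite bin_small.
Qed.

(** The summation range is extended to (n+1)p terms, so that j = j0 + j1 p runs over all pairs of
    digits and the sum factors. *)
Lemma lucas_Cseq (R : comNzRingType) (p m n : nat) :
  p \in [pchar R] -> p = m.*2.+1 ->
  (Cseq (m + n * p))%:R = (Cseq m)%:R * (Cseq n)%:R :> R.
Proof.
move=> charRp pE.
rewrite (@Cseq_widen _ (n.+1 * p)); last by rewrite mulSn; lia.
rewrite big_nat_mul (@Cseq_widen m p); last by lia.
rewrite (@Cseq_widen n n.+1) // [LHS]natr_sum [X in _ = _ * X]natr_sum mulr_sumr.
apply: eq_bigr => j1 _.
rewrite -{1}[(j1 * p)%N]add0n big_addn mulSn addnK !natr_sum mulr_suml.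
rewrite big_nat [RHS]big_nat; apply: eq_bigr => j0 /= lt_j0p.
rewrite !natrM lucas_bin //; last by lia.
(* For j0 <= m doubling j produces no carry, since 2 j0 <= 2m < p, so Lucas also applies to
   binom(2j, j); for j0 > m the factor binom(m, j0) is zero. *)
case: (leqP j0 m) => [le_j0m|lt_mj0]; last first.
  by rewrite (bin_small lt_mj0) !mul0r.
rewrite mulnDr mulnA lucas_bin //; last by lia.
by ring.
Qed.

(** Induction on r through (p^(r+1) - 1)/2 = m + p (p^r - 1)/2. *)
Lemma Cseq_half_expn (R : comNzRingType) (p m r : nat) :
  p \in [pchar R] -> p = m.*2.+1 ->
  (Cseq ((p ^ r - 1) %/ 2))%:R = (Cseq m)%:R ^+ r :> R.
Proof.
move=> charRp pE; elim: r => [|r IH].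
  by rewrite expn0 subnn div0n expr0 /Cseq big_ord1 !bin0.
have [k kE] : exists k, (p ^ r = k.*2.+1)%N.
  exists (p ^ r)./2; rewrite -[LHS]odd_double_half oddX pE /= odd_double orbT.
  by [].
rewrite exprS -IH -(lucas_Cseq _ charRp pE); congr (Cseq _)%:R.
rewrite expnS kE (_ : p * k.*2.+1 - 1 = 2 * (m + k * p))%N; last by rewrite pE; lia.
by rewrite mulKn // (_ : (k.*2.+1 - 1) %/ 2 = k)%N //; lia.
Qed.

(** * Inert primes *)

(** For p = 2 mod 3 the roots of X^2 - X + 1 lie outside the prime field, hence the splitting
    field. *)
Lemma exists_sixth_root (F : finFieldType) :
  exists (L : splittingFieldType F) (z : L), z * (1 - z) = 1.
Proof.
have nz : 'X^2 - 'X + 1 != 0 :> {poly F}.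
  apply/eqP => /(congr1 (fun P : {poly F} => P`_2)).
  rewrite !coefD coefN coefXn coefX coef1 coef0 /= subr0 addr0 => /eqP.
  by rewrite oner_eq0.
have [L [rs split_rs _]] := FinSplittingFieldFor nz.
exists L; move: split_rs.
rewrite !rmorphD rmorphN rmorph1 /= map_polyXn map_polyX => split_rs.
have sz : size ('X^2 - 'X + 1 : {poly L}) = 3%N.
  rewrite -addrA size_polyDl size_polyXn // (leq_ltn_trans (size_polyD _ _)) //.
  by rewrite gtn_max size_polyN size_polyX size_poly1.
have : size ('X^2 - 'X + 1 : {poly L}) = (size rs).+1.
  by rewrite (eqp_size split_rs) size_prod_XsubC.
rewrite sz; case: rs split_rs => // z rs split_rs _; exists z.
have : root ('X^2 - 'X + 1) z.
  by rewrite (eqp_root split_rs) root_prod_XsubC mem_head.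
rewrite /root !hornerE => /eqP z0.
by apply/eqP; rewrite -subr_eq0 -oppr_eq0; apply/eqP; rewrite -z0; ring.
Qed.

Lemma Cseq_half_inert (p m : nat) : prime p -> (3 < p)%N -> p = m.*2.+1 ->
  ~~ (3 %| m)%N -> (Cseq m)%:R = 0 :> 'F_p.
Proof.
move=> p_pr p_gt3 pE m3.
have [L [z z1]] := exists_sixth_root 'F_p.
have charF : p \in [pchar 'F_p] by apply: pchar_Fp.
have charL : p \in [pchar L] by rewrite pchar_lalg.
(* In both fields the vanishing of an integer means divisibility by p, so the result descends from
   [L]. *)
apply/eqP; rewrite -(dvdn_pcharf charF) (dvdn_pcharf charL); apply/eqP.
apply: (Cseq_half_eq0 charL pE _ z1) => //; last by lia.
by apply: (natr_lt_char_neq0 charL (j := 3)).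
Qed.

(** * Jacobsthal sums attached to cubes *)

Section Jacobsthal.
Variables (p f : nat).
Hypotheses (p_pr : prime p) (pE : p = (6 * f).+1).

Local Notation F := 'F_p.
Local Notation m := (3 * f)%N.

Let charF : p \in [pchar F]. Proof. exact: pchar_Fp. Qed.

Let f_gt0 : (0 < f)%N.
Proof. by case: f pE p_pr => // ->. Qed.

Let pred_pE : p.-1 = (m * 2)%N.
Proof. by rewrite pE /=; lia. Qed.

Lemma expF_pred (a : F) : a != 0 -> a ^+ p.-1 = 1.
Proof.
move=> nza; apply: (mulfI nza); rewrite -exprS mulr1 prednK ?prime_gt0 //.
by rewrite -[in RHS](expf_card a) card_Fp.
Qed.

(** The Legendre symbol by Euler's criterion, with integer values so that its sums are known exactly
    and not only modulo p. *)
Definition qchar (a : F) : int :=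
  if a == 0 then 0 else if a ^+ m == 1 then 1 else -1.

Lemma two_neq0 : 2 != 0 :> F.
Proof. by apply: (natr_lt_char_neq0 charF (j := 2)); lia. Qed.

Lemma three_neq0 : 3 != 0 :> F.
Proof. by apply: (natr_lt_char_neq0 charF (j := 3)); lia. Qed.

Lemma qchar_expr (a : F) : (qchar a)%:~R = a ^+ m.
Proof.
rewrite /qchar; have [->|nza] := eqVneq a 0; first by rewrite expr0n; case: f f_gt0.
have [-> //|n1] := eqVneq (a ^+ m) 1.
have : (a ^+ m) ^+ 2 == 1 by rewrite -exprM -pred_pE expF_pred.
by rewrite sqrf_eq1 (negPf n1) /= => /eqP ->; rewrite rmorphN1.
Qed.

Lemma qchar_val a : qchar a \in [:: 0; 1; -1].
Proof. by rewrite /qchar !inE; do 2?[case: ifP => _]. Qed.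

(** Since p is odd, 0, 1 and -1 stay distinct modulo p; identities for [qchar] can thus be checked
    on m-th powers. *)
Lemma sign_intr_inj (x y : int) : x \in [:: 0; 1; -1] -> y \in [:: 0; 1; -1] ->
  x%:~R = y%:~R :> F -> x = y.
Proof.
have := two_neq0; have := oner_neq0 F.
rewrite !inE => n1 n2 /or3P[]/eqP-> /or3P[]/eqP-> //;
  rewrite ?(mulr0z, mulr1z, mulrN1z) => /eqP.
- by rewrite eq_sym oppr_eq0 (negPf n1).
- by rewrite -subr_eq0 opprK (negPf n2).
- by rewrite oppr_eq0 (negPf n1).
- by rewrite eq_sym -subr_eq0 opprK (negPf n2).
Qed.

Lemma qcharM a b : qchar (a * b) = qchar a * qchar b.
Proof.
apply: sign_intr_inj; rewrite ?qchar_val //.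
  have := qchar_val a; have := qchar_val b.
  by rewrite !inE => /or3P[]/eqP-> /or3P[]/eqP->.
by rewrite rmorphM /= !qchar_expr exprMn.
Qed.

Lemma qchar0 : qchar 0 = 0. Proof. by rewrite /qchar eqxx. Qed.

Lemma qchar1 : qchar 1 = 1.
Proof. by rewrite /qchar oner_eq0 expr1n eqxx. Qed.

Lemma qchar_sqr a : a != 0 -> qchar a * qchar a = 1.
Proof. by rewrite /qchar => /negPf->; case: ifP. Qed.

Variable g : F.
Hypothesis g_prim : p.-1.-primitive_root g.

Let g_neq0 : g != 0.
Proof. by rewrite (prim_root_eq0 g_prim) pred_pE; lia. Qed.

Lemma prim_root_half : g ^+ m = -1.
Proof.
have : (g ^+ m) ^+ 2 == 1 by rewrite -exprM -pred_pE (prim_expr_order g_prim).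
rewrite sqrf_eq1 => /orP[|/eqP//].
by rewrite -(prim_order_dvd g_prim) pred_pE => /dvdn_leq; lia.
Qed.

Lemma qchar_prim : qchar g = -1.
Proof.
apply: sign_intr_inj; rewrite ?qchar_val //.
by rewrite qchar_expr prim_root_half rmorphN1.
Qed.

Lemma sum_prim_root (R : nmodType) (h : F -> R) :
  \sum_(a | a != 0) h a = \sum_(i < 6 * f) h (g ^+ i).
Proof.
have inj : injective (fun i : 'I_(6 * f) => g ^+ i).
  move=> i j /eqP; rewrite (eq_prim_root_expr g_prim) pred_pE.
  by rewrite !modn_small => [/eqP /val_inj //||];
    have := ltn_ord i; have := ltn_ord j; lia.
rewrite -(big_imset _ (h := fun i : 'I_(6 * f) => g ^+ i) (A := predT)) /=; last first.
  by move=> i j _ _; apply: inj.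
apply: eq_bigl => a; apply/idP/imsetP => [nza|[i _ ->]]; last first.
  by rewrite expf_neq0.
have [i ->] := prim_rootP g_prim (expF_pred nza).
have lt_i : (i < 6 * f)%N by have := ltn_ord i; rewrite {2}pE.
by exists (Ordinal lt_i).
Qed.

Lemma sum_split0 (h : F -> int) : \sum_a h a = h 0 + \sum_(a | a != 0) h a.
Proof. by rewrite (bigD1 0). Qed.

Lemma sum_scale (R : nmodType) (h : F -> R) (c : F) : c != 0 ->
  \sum_a h (c * a) = \sum_a h a.
Proof. by move=> nzc; rewrite [RHS](reindex_inj (mulfI nzc)). Qed.

Lemma sum_shift (R : nmodType) (h : F -> R) (c : F) :
  \sum_a h (c + a) = \sum_a h a.
Proof. by rewrite [RHS](reindex_inj (addrI c)). Qed.

Lemma sum_qchar : \sum_a qchar a = 0.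
Proof.
have : \sum_a qchar (g * a) = \sum_a qchar a by apply: sum_scale.
rewrite (eq_bigr (fun a => - qchar a)) => [|a _]; last by rewrite qcharM qchar_prim mulN1r.
by rewrite sumrN; move: (\sum_a qchar a) => S; lia.
Qed.

Lemma sum_qchar_shift s t :
  \sum_u qchar (u + s) * qchar (u + t) = (s == t)%:Z * p%:Z - 1.
Proof.
have -> : \sum_u qchar (u + s) * qchar (u + t) = \sum_u qchar u * qchar (u + (t - s)).
  rewrite -[RHS](sum_shift _ s); apply: eq_bigr => u _.
  by rewrite [s + u]addrC -addrA [s + _]addrCA subrr addr0.
have -> : (s == t) = (t - s == 0) by rewrite subr_eq0 eq_sym.
move: (t - s) => c; rewrite sum_split0 qchar0 mul0r add0r.
have [->|nzc] /= := eqVneq c 0.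
  rewrite (eq_bigr (fun _ => 1)) => [|u nzu]; last by rewrite addr0 qchar_sqr.
  rewrite sumr_const cardC1 card_Fp // natz mul1r; have := prime_gt0 p_pr; lia.
(* With v = 1/u, the product of the symbols of u and u + c is the symbol of 1 + cv. The full sum
   over v is 0, and the missing v = 0 accounts for -1. *)
rewrite (reindex_onto (fun v => v^-1) (fun v => v^-1)) => [|u _]; last by rewrite invrK.
rewrite (eq_bigr (fun v => qchar (1 + c * v))) => [|v]; last first.
  rewrite invr_eq0 => /andP[nzv _].
  have vE : v^-1 * (v^-1 + c) = (v^-1 * v^-1) * (1 + c * v).
    by rewrite !mulrDr mulr1 [c * v]mulrC mulrA mulfVK.
  by rewrite -qcharM vE qcharM qcharM qchar_sqr ?invr_eq0 ?mul1r.
rewrite (eq_bigl (fun v => v != 0)) => [|v]; last by rewrite invr_eq0 invrK eqxx andbT.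
have := sum_split0 (fun v => qchar (1 + c * v)).
rewrite (sum_scale (fun v => qchar (1 + v))) // sum_shift sum_qchar mulr0 addr0 qchar1.
by rewrite mul0r sub0r => /esym/eqP; rewrite addrC addr_eq0 => /eqP.
Qed.

(** For a != 0, minus the trace of Frobenius of the elliptic curve y^2 = x^3 + a. *)
Definition cubic_sum (a : F) : int := \sum_t qchar (a + t ^+ 3).

Lemma sum_qchar_cube : \sum_(t : F) qchar (t ^+ 3) = 0.
Proof.
rewrite -[RHS]sum_qchar; apply: eq_bigr => t _.
have [->|nzt] := eqVneq t 0; first by rewrite expr0n.
by rewrite !exprS expr0 mulr1 !qcharM qchar_sqr // mulr1.
Qed.

Lemma cubic_sum0 : cubic_sum 0 = 0.
Proof. by rewrite -[RHS]sum_qchar_cube; apply: eq_bigr => t _; rewrite add0r. Qed.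

(** Replacing t by g t pulls out g^3, a non-residue. *)
Lemma cubic_sum_shift3 i : cubic_sum (g ^+ (i + 3)) = - cubic_sum (g ^+ i).
Proof.
rewrite /cubic_sum -(sum_scale _ g_neq0) -sumrN; apply: eq_bigr => t _.
have -> : g ^+ (i + 3) + (g * t) ^+ 3 = g ^+ 3 * (g ^+ i + t ^+ 3).
  by rewrite exprD exprMn mulrDr [g ^+ i * _]mulrC.
have g3 : qchar (g ^+ 3) = -1 by rewrite !exprS expr0 mulr1 !qcharM qchar_prim.
by rewrite qcharM g3 mulN1r.
Qed.

Lemma sum_period3 (h : nat -> int) k : (forall i, h (i + 3)%N = h i) ->
  \sum_(i < 3 * k) h i = k%:Z * (h 0%N + h 1%N + h 2%N).
Proof.
move=> per; elim: k => [|k IH]; first by rewrite big_ord0 mul0r.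
have perk i j : h (j + 3 * i)%N = h j.
  by elim: i => [|i IHi]; rewrite ?addn0 // mulnS addnCA addnC per.
rewrite mulnS addnC !addnS addn0 !big_ord_recr /= IH.
have := perk k 0%N; have := perk k 1%N; have := perk k 2%N.
rewrite add0n add1n add2n => -> -> ->; rewrite intS; ring.
Qed.

Let A i := cubic_sum (g ^+ i).

(** The correlation of [qchar] with [cubic_sum] is p - p = 0 by [sum_qchar_shift]; along the powers
    of g it equals 2f (A 0 - A 1 + A 2). *)
Lemma cubic_sum_linear : A 1 = A 0 + A 2.
Proof.
have sum0 : \sum_a qchar a * cubic_sum a = 0.
  have -> : \sum_a qchar a * cubic_sum a
            = \sum_t \sum_a qchar (a + 0) * qchar (a + t ^+ 3).
    rewrite exchange_big; apply: eq_bigr => a _; rewrite mulr_sumr.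
    by apply: eq_bigr => t _; rewrite addr0.
  rewrite (eq_bigr (fun t => (t == 0)%:Z * p%:Z - 1)) => [|t _]; last first.
    by rewrite sum_qchar_shift eq_sym expf_eq0.
  rewrite (bigD1 0) //= mul1r (eq_bigr (fun _ => -1)) => [|t /negPf->]; last first.
    by rewrite mul0r add0r.
  rewrite sumr_const cardC1 card_Fp // -mulr_natr natz; have := prime_gt0 p_pr; lia.
move: sum0; rewrite sum_split0 qchar0 mul0r add0r sum_prim_root.
rewrite (_ : 6 * f = 3 * (2 * f))%N; last by lia.
have qg i : qchar (g ^+ i) = (-1) ^+ i.
  by elim: i => [|i IHi]; rewrite ?expr0 ?qchar1 // !exprS qcharM qchar_prim IHi.
rewrite (sum_period3 (h := fun i => qchar (g ^+ i) * cubic_sum (g ^+ i))) => [|i].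
  rewrite !qg !expr0 expr1 -/(A 0) -/(A 1) -/(A 2).
  rewrite (_ : (-1) ^+ 2 = 1) // => /eqP; rewrite mulf_eq0; lia.
rewrite cubic_sum_shift3 !qg exprD (_ : (-1) ^+ 3 = -1) //; ring.
Qed.

Lemma cube_root_unity : exists w : F, w ^+ 2 + w + 1 = 0.
Proof.
exists (g ^+ (2 * f)); set w := g ^+ _.
have w3 : (w - 1) * (w ^+ 2 + w + 1) = 0.
  have -> : (w - 1) * (w ^+ 2 + w + 1) = w ^+ 3 - 1 by ring.
  rewrite -exprM (_ : 2 * f * 3 = p.-1)%N ?(prim_expr_order g_prim) ?subrr //.
  by rewrite pred_pE; lia.
have w1 : w != 1.
  rewrite -(prim_order_dvd g_prim) pred_pE; apply/negP => /dvdn_leq; lia.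
by move/eqP: w3; rewrite mulf_eq0 subr_eq0 (negPf w1) /= => /eqP.
Qed.

Lemma sum_eq_delta (c : F) : \sum_t (t == c)%:Z = 1.
Proof.
by rewrite (bigD1 c) //= eqxx big1 ?addr0 // => t /negPf->.
Qed.

(** The cube roots of s^3 are s, ws and w^2 s with w^2 = -(1 + w); a coincidence of two of them
    would force 3 = 0. *)
Lemma sum_eq_cube (s : F) : s != 0 -> \sum_t (t ^+ 3 == s ^+ 3)%:Z = 3.
Proof.
move=> nzs; have [w w0] := cube_root_unity.
rewrite (eq_bigr (fun t => (t == s)%:Z + (t == w * s)%:Z + (t == - (1 + w) * s)%:Z)).
  by rewrite !big_split /= !sum_eq_delta.
move=> t _; have -> : (t ^+ 3 == s ^+ 3) = [|| t == s, t == w * s | t == - (1 + w) * s].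
  rewrite -subr_eq0.
  have -> : t ^+ 3 - s ^+ 3 = (t - s) * ((t - w * s) * (t - - (1 + w) * s)) -
      (w ^+ 2 + w + 1) * (s ^+ 3 - s ^+ 2 * t) by ring.
  by rewrite w0 mul0r subr0 !mulf_eq0 !subr_eq0.
have n3 := three_neq0.
have d1 : s != w * s.
  apply: contra n3; rewrite -subr_eq0 -[X in X - _]mul1r -mulrBl mulf_eq0 (negPf nzs) orbF.
  move=> /eqP w1; have -> : 3 = (w ^+ 2 + w + 1) + (1 - w) * (w + 2) :> F by ring.
  by rewrite w0 w1 mul0r addr0.
have d2 : s != - (1 + w) * s.
  apply: contra n3; rewrite -subr_eq0 -[X in X - _]mul1r -mulrBl mulf_eq0 (negPf nzs) orbF.
  move=> /eqP w1.
  have -> : 3 = (w ^+ 2 + w + 1) - (1 - - (1 + w)) * (w - 1) :> F by ring.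
  by rewrite w0 w1 mul0r subr0.
have d3 : w * s != - (1 + w) * s.
  apply: contra n3; rewrite -subr_eq0 -mulrBl mulf_eq0 (negPf nzs) orbF.
  move=> /eqP w1.
  have -> : 3 = 4 * (w ^+ 2 + w + 1) - (w - - (1 + w)) ^+ 2 :> F by ring.
  by rewrite w0 w1 mulr0 expr0n subr0.
have [->|] := eqVneq t s; first by rewrite (negPf d1) (negPf d2).
by have [->|//] := eqVneq t (w * s); rewrite (negPf d3).
Qed.

(** The second moment of [cubic_sum] is computed twice: orthogonality gives p(3p - 2) - p^2 =
    2p(p-1), and the period 3 of the squares gives 2f times the left side. *)
Lemma cubic_sum_sqr : A 0 ^+ 2 + A 1 ^+ 2 + A 2 ^+ 2 = 6 * p%:Z.
Proof.
have sumE : \sum_a cubic_sum a ^+ 2 = 2 * p%:Z * (6 * f)%:Z.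
  have -> : \sum_a cubic_sum a ^+ 2
            = \sum_s \sum_t \sum_a qchar (a + t ^+ 3) * qchar (a + s ^+ 3).
    under [RHS]eq_bigr do rewrite exchange_big.
    rewrite [RHS]exchange_big; apply: eq_bigr => a _.
    rewrite expr2 mulr_sumr; apply: eq_bigr => s _.
    by rewrite mulr_suml.
  (* The factor 3 - 2 [s = 0] is the number of cube roots of s^3. *)
  have sumt (s : F) : \sum_t \sum_a qchar (a + t ^+ 3) * qchar (a + s ^+ 3)
        = (3 - 2 * (s == 0)%:Z) * p%:Z - p%:Z.
    under eq_bigr do rewrite sum_qchar_shift.
    rewrite big_split /= -mulr_suml sumr_const card_Fp // mulNrn.
    congr (_ * _ - _); last by rewrite natz.
    have [->|nzs] := eqVneq s 0; last by rewrite sum_eq_cube.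
    rewrite -[RHS](sum_eq_delta 0); apply: eq_bigr => t _.
    by rewrite [0 ^+ 3]expr0n expf_eq0.
  rewrite (eq_bigr _ (fun s _ => sumt s)) big_split /= -mulr_suml big_split /=.
  rewrite sumrN -mulr_sumr.
  have cst (c : int) : \sum_(t : F) c = c * p%:Z.
    by rewrite sumr_const card_Fp // -mulr_natr natz.
  have fE : (6 * f)%:Z = p%:Z - 1 by rewrite pE; lia.
  by rewrite sum_eq_delta !cst fE; ring.
move: sumE; rewrite sum_split0 cubic_sum0 expr0n add0r sum_prim_root.
rewrite (_ : 6 * f = 3 * (2 * f))%N; last by lia.
rewrite (sum_period3 (h := fun i => cubic_sum (g ^+ i) ^+ 2)) => [|i].
  rewrite -/(A 0) -/(A 1) -/(A 2); move: f_gt0 (_ + _) => f0 S.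
  move=> e; have /eqP : f%:Z * (S - 6 * p%:Z) = 0 by lia.
  by rewrite mulf_eq0 subr_eq0 => /orP[|/eqP//]; lia.
by rewrite cubic_sum_shift3 sqrrN.
Qed.

(** With B the number of t for which 1 + t^3 is a non-residue, A 0 = p - 3 - 2B, as 1 + t^3 has
    three zeros. *)
Lemma cubic_sum_even : exists u : int, A 0 = 2 * u.
Proof.
have qE a : qchar a = 1 - (a == 0)%:Z - 2 * (qchar a == -1)%:Z.
  by rewrite /qchar; case: ifP => // _; case: ifP.
rewrite /A expr0 /cubic_sum (eq_bigr _ (fun t _ => qE (1 + t ^+ 3))).
rewrite !big_split /= !sumrN -mulr_sumr sumr_const card_Fp // natz.
have -> : \sum_t (1 + t ^+ 3 == 0 :> F)%:Z = 3.
  rewrite -(@sum_eq_cube (-1)) ?oppr_eq0 ?oner_eq0 //; apply: eq_bigr => t _.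
  by rewrite addrC addr_eq0 (_ : (-1) ^+ 3 = -1) //; ring.
move: (\sum_t _) => B.
by exists ((3 * f)%:Z - 1 - B); rewrite pE; lia.
Qed.

Lemma sum_expr k : k != 0%N -> \sum_(t : F) t ^+ k = if (p.-1 %| k)%N then -1 else 0.
Proof.
move=> nzk; case: ifP => [/dvdnP[q kE]|ndvd].
  rewrite (bigD1 0) //= expr0n (negPf nzk) add0r (eq_bigr (fun _ => 1)).
    rewrite sumr_const cardC1 card_Fp //; apply/eqP.
    by rewrite -subr_eq0 opprK natr1 prednK ?prime_gt0 // pcharf0.
  by move=> t nzt; rewrite kE mulnC exprM expF_pred // expr1n.
have : \sum_(t : F) (g * t) ^+ k = \sum_(t : F) t ^+ k.
  exact: (sum_scale (fun t => t ^+ k) g_neq0).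
under eq_bigr do rewrite exprMn.
rewrite -mulr_sumr => /eqP; rewrite -subr_eq0 -[X in _ - X]mul1r -mulrBl mulf_eq0.
by rewrite subr_eq0 -(prim_order_dvd g_prim) ndvd /= => /eqP.
Qed.

(** Euler's criterion turns A 0 into the sum of (1 + t^3)^m. Among the exponents 3i <= 9f, only 3i =
    6f = p-1 is a positive multiple of p-1, so binom(m, 2f) = binom(m, f) remains; i = 0 contributes
    p = 0. *)
Lemma cubic_sum1_bin : (A 0)%:~R = - 'C(m, f)%:R :> F.
Proof.
rewrite /A expr0 /cubic_sum rmorph_sum /=.
under eq_bigr do rewrite qchar_expr exprDn.
rewrite exchange_big /=.
have lt2f : (2 * f < m.+1)%N by lia.
rewrite (bigD1 (Ordinal lt2f)) //= [X in _ + X]big1 => [|i neq_i].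
  under eq_bigr do rewrite expr1n mul1r -exprM -mulr_natr.
  rewrite -mulr_suml sum_expr; last by lia.
  rewrite (_ : 3 * (2 * f) = p.-1)%N; last by rewrite pred_pE; lia.
  rewrite dvdnn mulN1r addr0 -bin_sub; last by lia.
  by congr (- 'C(_, _)%:R); lia.
under eq_bigr do rewrite expr1n mul1r -exprM -mulr_natr.
rewrite -mulr_suml; have [i0|nzi] := eqVneq (i : nat) 0%N.
  rewrite i0 muln0 (eq_bigr (fun _ => 1)) // sumr_const card_Fp //.
  by rewrite pcharf0 // mul0r.
rewrite sum_expr; last by lia.
case: ifP => [/dvdnP[q]|]; last by rewrite mul0r.
rewrite pred_pE => e; have lt_i := ltn_ord i.
case/eqP: neq_i; apply/val_inj => /=.
have : q = 1%N by nia.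
by move=> q1; move: e; rewrite q1; lia.
Qed.

(** Put A 0 = 2u and A 1 = A 0 + A 2 in the quadratic relation: it becomes (A 2 + u)^2 = 3(p - u^2),
    so A 2 + u = 3v and p = u^2 + 3v^2. *)
Lemma prime_sqr_3sqr : exists u v : int,
  p%:Z = u ^+ 2 + 3 * v ^+ 2 /\ 'C(m, f)%:R ^+ 2 = (4 * u ^+ 2)%:~R :> F.
Proof.
have [u A0E] := cubic_sum_even.
have := cubic_sum_sqr; rewrite cubic_sum_linear A0E => sqE.
have eqE : (A 2 + u) ^+ 2 = 3 * (p%:Z - u ^+ 2) by lia.
have [v vE] : exists v, A 2 + u = 3 * v.
  exists ((A 2 + u) %/ 3)%Z; move: eqE; move: (A 2 + u) => x.
  have := modz_ge0 x (isT : (3 != 0 :> int)); have := ltz_pmod x (isT : (0 < 3 :> int)).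
  move: (divz_eq x 3) (p%:Z - u ^+ 2); move: (x %/ 3)%Z (x %% 3)%Z => q r -> M lt3 ge0.
  have [->|[->|->]] : r = 0 \/ r = 1 \/ r = 2 by lia.
  - by rewrite addr0 mulrC.
  - have -> : (q * 3 + 1) ^+ 2 = 3 * (3 * q ^+ 2 + 2 * q) + 1 by ring.
    by move: (3 * q ^+ 2 + 2 * q) => N; lia.
  - have -> : (q * 3 + 2) ^+ 2 = 3 * (3 * q ^+ 2 + 4 * q + 1) + 1 by ring.
    by move: (3 * q ^+ 2 + 4 * q + 1) => N; lia.
exists u, v; split.
  move: eqE; have -> : (A 2 + u) ^+ 2 = 3 * (3 * v ^+ 2) by rewrite vE; ring.
  by move: (3 * v ^+ 2) (u ^+ 2) => M N; lia.
rewrite -[_ ^+ 2]sqrrN -cubic_sum1_bin A0E -rmorphXn /=; congr (_%:~R); ring.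
Qed.

End Jacobsthal.

Lemma exists_prim_root_Fp (p : nat) : prime p ->
  exists g : 'F_p, p.-1.-primitive_root g.
Proof.
move=> p_pr; set rs := [seq a : 'F_p <- enum 'F_p | a != 0].
have : has p.-1.-primitive_root rs.
  apply: has_prim_root; rewrite ?(filter_uniq _ (enum_uniq _)) //.
  - by rewrite -ltnS prednK ?prime_gt0 ?prime_gt1.
  - by apply/allP => a; rewrite mem_filter unity_rootE => /andP[/(expF_pred p_pr)->].
  - have <- : #|predC1 (0 : 'F_p)| = p.-1 by rewrite cardC1 card_Fp.
    rewrite cardE uniq_leq_size ?enum_uniq // => a.
    by rewrite mem_enum mem_filter mem_enum andbT.
by case/hasP => g _; exists g.
Qed.

Lemma Cseq_half_split (p f : nat) : prime p -> p = (6 * f).+1 ->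
  exists u v : int, p%:Z = u ^+ 2 + 3 * v ^+ 2 /\
    (Cseq (3 * f))%:R = (4 * u ^+ 2)%:~R :> 'F_p.
Proof.
move=> p_pr pE; have [g g_prim] := exists_prim_root_Fp p_pr.
have [u [v [puv binE]]] := prime_sqr_3sqr p_pr pE g_prim.
exists u, v; split => //; rewrite -binE.
have [w w0] := cube_root_unity p_pr pE g_prim.
have n3 := three_neq0 p_pr pE.
have f0 : (0 < f)%N by case: f pE p_pr {binE} => // ->.
(* The negative of a primitive cube root of unity is a primitive sixth root, here in the prime field
   itself. *)
have z1 : - w * (1 - - w) = 1.
  have -> : - w * (1 - - w) = 1 - (w ^+ 2 + w + 1) by ring.
  by rewrite w0 subr0.
have pE' : p = (3 * f).*2.+1 by rewrite pE; lia.
apply: (Cseq_half_third (pchar_Fp p_pr) pE' n3 z1 f0 erefl).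
(* As -3 is a square, its m-th power is a (p-1)-th power, hence 1. *)
have m3 : - 3 = (1 + 2 * w) ^+ 2 :> 'F_p.
  have -> : (1 + 2 * w) ^+ 2 = 4 * (w ^+ 2 + w + 1) - 3 by ring.
  by rewrite w0 mulr0 sub0r.
have nz : 1 + 2 * w != 0.
  by apply: contra n3 => /eqP e; move: m3; rewrite e expr0n => /eqP; rewrite oppr_eq0.
rewrite m3 -exprM (_ : 2 * (3 * f) = p.-1)%N ?expF_pred //; last by rewrite pE /=; lia.
Qed.

(** * Traces in characteristic zero and conclusion *)

Lemma eqz_mod_Fp (p : nat) (a b : int) : prime p ->
  a%:~R = b%:~R :> 'F_p -> (a = b %[mod p%:Z])%Z.
Proof.
move=> p_pr eq_ab; apply/eqP; rewrite eqz_mod_dvd.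
have : (a - b)%:~R = 0 :> 'F_p by rewrite rmorphB /= eq_ab subrr.
by move/eqP; rewrite -(dvdz_pcharf (pchar_Fp p_pr)).
Qed.

(* The power sums of the roots of [T^2 - (4 x^2 - 2 p) T + p^2], which is
   congruent to [T (T - 4 x^2)] modulo [p]. *)
Lemma trace_pow (C : comNzRingType) (s : C) (x y : int) (p r : nat) :
  prime p -> s ^+ 2 = - 3 -> p%:Z = x ^+ 2 + 3 * y ^+ 2 ->
  exists g : int,
    (x%:~R + y%:~R * s) ^+ (2 * r.+1) + (x%:~R - y%:~R * s) ^+ (2 * r.+1) = g%:~R
    /\ g%:~R = (4 * x ^+ 2)%:~R ^+ r.+1 :> 'F_p.
Proof.
move=> p_pr s2 pxy; rewrite !exprM.
set P := (_ + _) ^+ 2; set Q := (_ - _) ^+ 2.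
pose T : int := 4 * x ^+ 2 - 2 * p%:Z.
have PQ : P + Q = T%:~R.
  have -> : P + Q = 2 * x%:~R ^+ 2 + 2 * y%:~R ^+ 2 * s ^+ 2 by rewrite /P /Q; ring.
  by rewrite s2 /T pxy !(rmorphD, rmorphN, rmorphM, rmorphXn) /=; ring.
have PMQ : P * Q = (p%:Z ^+ 2)%:~R.
  have -> : P * Q = (x%:~R ^+ 2 - y%:~R ^+ 2 * s ^+ 2) ^+ 2 by rewrite /P /Q; ring.
  by rewrite s2 pxy !(rmorphD, rmorphN, rmorphM, rmorphXn) /=; ring.
have p0 : p%:Z%:~R = 0 :> 'F_p by rewrite -pmulrn pchar_Fp_0.
have Tp : T%:~R = (4 * x ^+ 2)%:~R :> 'F_p.
  by rewrite /T rmorphB [X in _ - X]rmorphM /= p0 mulr0 subr0.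
move: (4 * x ^+ 2) Tp => U TU.
(* The power sums obey a second-order recurrence, so the induction carries two consecutive ones. *)
suff [g [h [gE _ gp _]]] : exists g h : int,
  [/\ P ^+ r.+1 + Q ^+ r.+1 = g%:~R, P ^+ r.+2 + Q ^+ r.+2 = h%:~R,
      g%:~R = U%:~R ^+ r.+1 :> 'F_p & h%:~R = U%:~R ^+ r.+2 :> 'F_p].
  by exists g.
elim: r => [|r [g [h [gE hE gp hp]]]].
  exists T, (T ^+ 2 - 2 * p%:Z ^+ 2); split; rewrite ?expr1 //.
    by rewrite rmorphB rmorphXn [X in _ = _ - X]rmorphM /= -PQ -PMQ; ring.
  rewrite rmorphB rmorphXn [X in _ - X]rmorphM [X in _ - _ * X]rmorphXn /=.
  by rewrite p0 TU expr0n mulr0 subr0.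
exists h, (T * h - p%:Z ^+ 2 * g); split=> //.
  by rewrite rmorphB 2!rmorphM /= -PMQ -PQ -gE -hE !exprS; ring.
by rewrite rmorphB 2!rmorphM rmorphXn /= p0 expr0n mul0r subr0 TU hp -exprS.
Qed.

(** As p != 3, u is prime to 3 and one of u, -u is 1 mod 3; as p is not a square, v != 0. *)
Lemma normalize_sqr_3sqr (p : nat) (u v : int) : prime p -> (3 < p)%N ->
  p%:Z = u ^+ 2 + 3 * v ^+ 2 ->
  exists x y : int, [/\ p%:Z = x ^+ 2 + 3 * y ^+ 2, (x = 1 %[mod 3])%Z, 0 < y
    & x ^+ 2 = u ^+ 2].
Proof.
move=> p_pr p_gt3 puv.
have p3 : ~~ (3 %| p)%N.
  by rewrite dvdn_prime2 //; apply/eqP => p3; rewrite -p3 in p_gt3.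
have nzv : v != 0.
  apply/eqP => v0; move: puv; rewrite v0 expr0n mulr0 addr0 => pu.
  have {pu}pu : (p = `|u| * `|u|)%N by nia.
  have : (`|u| %| p)%N by rewrite pu dvdn_mulr.
  case/primeP: p_pr => p1 pr /pr /orP[]/eqP uE; rewrite uE in pu; nia.
have [x [x1 xu]] : exists x : int, (x = 1 %[mod 3])%Z /\ (x = u \/ x = - u).
  have : (u %% 3)%Z = 0 \/ (u %% 3)%Z = 1 \/ (u %% 3)%Z = 2 by lia.
  case=> [u0|[u1|u2]]; last 2 first.
  - by exists u; split; [lia|left].
  - by exists (- u); split; [lia|right].
  case/negP: p3; have [q uE] : exists q, u = 3 * q by exists (u %/ 3)%Z; lia.
  have : (3 %| p%:Z)%Z by apply/dvdzP; exists (3 * q ^+ 2 + v ^+ 2); rewrite puv uE; ring.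
  by rewrite dvdzE.
exists x, `|v|; split=> //; rewrite ?normr_gt0 // ?real_normK ?num_real //.
  by case: xu => ->; rewrite ?sqrrN.
by case: xu => ->; rewrite ?sqrrN.
Qed.

Theorem theorem1p4 (R : realType)
    (f : nat -> R[i] -> R[i]) (gamma : nat -> nat -> R[i])
    (hf : forall k : nat, (2 <= k)%N -> is_fk k (f k) (gamma k))
    (p r : nat) (hp : prime p) (hp3 : (3 < p)%N) (hr : (1 <= r)%N) :
  exists g : int,
    gamma (2 * r + 1)%N p = g%:~R /\
    ((Cseq ((p ^ r - 1) %/ 2))%:Z = g %[mod p%:Z])%Z.
Proof.
have p_odd : odd p by case: (even_prime hp) hp3 => [->|].
have [_ _ /(_ p hp p_odd) [split_coef _ inert_coef]] :
    is_fk (2 * r + 1) (f (2 * r + 1)%N) (gamma (2 * r + 1)%N).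
  by apply: hf; lia.
have pE : p = (p./2).*2.+1 by rewrite -[LHS]odd_double_half p_odd.
have CE := Cseq_half_expn r (pchar_Fp hp) pE.
have p3 : ~~ (3 %| p)%N.
  by rewrite dvdn_prime2 //; apply/eqP => p3; rewrite -p3 in hp3.
(* A prime p > 3 that is not 1 mod 6 is 5 mod 6: then the coefficient is 0 and p divides C(m), so
   its r-th power vanishes because r >= 1. *)
have [p1|p1] := eqVneq (p %% 6)%N 1%N; last first.
  exists 0; split.
    apply: inert_coef; first by rewrite (modn_small (isT : 1 < 6)%N); apply/eqP.
    by case=> p3'; rewrite p3' in hp3.
  apply: eqz_mod_Fp => //; rewrite -pmulrn CE Cseq_half_inert //; last by lia.
  by rewrite expr0n eqn0Ngt hr.
have [k pk] : exists k, p = (6 * k).+1 by exists (p %/ 6)%N; lia.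
have [u [v [puv Cu]]] := Cseq_half_split hp pk.
(* The coefficient formula requires the normalized representation, while the congruence involves
   only x^2 = u^2. *)
have [x [y [pxy x1 y0 xu]]] := normalize_sqr_3sqr hp hp3 puv.
have s2 : sqrtC (- 3 : R[i]) ^+ 2 = - 3 by rewrite sqrtCK.
have [g [gE gp]] := trace_pow r.-1 hp s2 pxy.
exists g; split.
  rewrite (split_coef _ x y) // addnK.
  by move: gE; rewrite prednK.
apply: eqz_mod_Fp => //; rewrite gp prednK // -pmulrn CE xu -Cu.
by congr ((Cseq _)%:R ^+ _); lia.
Qed.
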